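(* Let $G$ be a finitely generated, infinite, two-step nilpotent group. Then there exists $k(G)\in\mathbb{N}$ such that $\mathrm{RF}_G \preceq \log^{2k(G)+1}$.
   Context: $\mathbb{N}=\{1,2,\ldots\}$. A group is two-step nilpotent if it is nilpotent with step length (nilpotency class) $2$. Residual finiteness growth: let $G$ be a finitely generated residually finite group with finite generating set $S$, neutral element $e$, and word norm $\|g\|_S=\min\{k\geq 0\mid g=s_1^{\pm1}\cdots s_k^{\pm1}, s_i\in S\}$; put $B_S(r)=\{g\in G\mid \|g\|_S\le r\}$. The divisibility function is $D_G(g)=\min\{[G:N]\mid g\notin N, N\lhd G\}$ for $g\ne e$. Define $\mathrm{RF}_{G,S}(r)=\max\{D_G(g)\mid e\neq g\in B_S(r)\}$ for real $r\geq 1$. (Finitely generated nilpotent groups are residually finite.) For non-decreasing functions $f,g$ on $\mathbb{R}_{\ge1}$, write $f\preceq g$ if there is $C>0$ such that $f(r)\le C g(Cr)$ for all $r\ge\max\{1,1/C\}$, and $f\approx g$ if $f\preceq g$ and $g\preceq f$. Up to $\approx$, $\mathrm{RF}_{G,S}$ does not depend on $S$, and $\mathrm{RF}_G$ denotes its equivalence class. $\log^k$ denotes the function $r\mapsto(\log r)^k$. *)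

(* Defs.v *)
From HB Require Import structures.
From mathcomp Require Import all_boot all_order all_algebra.
From mathcomp Require Import all_classical all_reals all_analysis.

Set Implicit Arguments.
Unset Strict Implicit.
Unset Printing Implicit Defensive.

Import Order.TTheory GRing.Theory Num.Theory.
Local Open Scope classical_set_scope.
Local Open Scope card_scope.
Local Open Scope group_scope.

Section Groups.
Variable G : groupType.
Implicit Types (A B H N S : set G) (g x y : G).

Definition is_subgroup H : Prop := group_closed (mem H).

Definition is_normal_subgroup N : Prop :=
  is_subgroup N /\ forall x y, N x -> N (x ^ y).

Definition gen A : set G := smallest is_subgroup A.

Definition generates S : Prop := gen S = [set: G].

Definition finitely_generated : Prop :=
  exists S, finite_set S /\ generates S.

Definition commutator_subgroup A B : set G :=
  gen [set z | exists x y, [/\ A x, B y & z = [~ x, y]]].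

(* Indexed from 0: [lower_central 0] is G itself, so a group of class c is one
   whose first trivial term is [lower_central c]. *)
Fixpoint lower_central (n : nat) : set G :=
  if n is m.+1 then commutator_subgroup (lower_central m) [set: G]
  else [set: G].

Definition nilpotent_of_class (c : nat) : Prop :=
  lower_central c = [set 1]
  /\ forall m, (m < c)%N -> lower_central m <> [set 1].

Definition left_coset x N : set G := [set x * y | y in N].

Definition has_index N (n : nat) : Prop :=
  [set left_coset x N | x in [set: G]] #= `I_n.

End Groups.

Definition two_step_nilpotent (G : groupType) : Prop :=
  @nilpotent_of_class G 2.

Section Growth.
Variables (R : realType) (G : groupType).
Implicit Types (S : set G) (g : G) (r : R).

(* The minimum of a set of natural numbers, with value +oo on the empty set:
   on a nonempty set of naturals the infimum is attained. *)
Definition emin (A : set nat) : \bar R :=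
  ereal_inf [set (n%:R)%:E | n in A].

Definition is_word_length S g (k : nat) : Prop :=
  exists s : 'I_k -> G,
    (forall i, S (s i) \/ S (s i)^-1) /\ g = \prod_(i < k) s i.

Definition word_norm S g : \bar R := emin [set k | is_word_length S g k].

Definition word_ball S r : set G := [set g | (word_norm S g <= r%:E)%E].

(* +oo when g lies in every normal subgroup of finite index; in a residually
   finite group this happens only for g = 1. *)
Definition divisibility g : \bar R :=
  emin [set n | exists N, [/\ is_normal_subgroup N, ~ N g & has_index N n]].

(* For finite S the ball is finite, so the supremum is a maximum whenever the
   ball contains a nontrivial element. *)
Definition RF S r : \bar R :=
  ereal_sup [set divisibility g | g in [set g | g <> 1 /\ word_ball S r g]].

(* Only the values of f and h on [1, +oo[ matter, as r and C * r are both at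
   least 1. *)
Definition preceq (f h : R -> \bar R) : Prop :=
  exists C : R, (0 < C)%R /\
    forall r, (Num.max 1 C^-1 <= r)%R -> (f r <= C%:E * h (C * r)%R)%E.

Definition log_pow (m : nat) (r : R) : \bar R := ((ln r) ^+ m)%R%:E.

End Growth.
Arguments word_norm R {G} S g.
Arguments divisibility R {G} g.
Arguments RF R {G} S r.
Arguments log_pow R m r : clear implicits.

(* Main.v *)
(* Let x_1, ..., x_n generate G. If g <> 1 is not an l-th power in G, then g
   survives in the quotient by the normal subgroup of all u^(2l) z^l with z
   central: every element of that subgroup is the l-th power of u^2 z. Writing
   elements as prod x_i^(c_i) prod [x_i, x_j]^(e_ij) and reducing all exponents
   modulo 2l, the index of that subgroup is at most (2l)^(n + n^2).

   It remains to find l = O(log r) such that g, of length at most r, is not an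
   l-th power. The relations satisfied by the c_i form a subgroup of Z^n, which
   has finite exponent t in the common kernel of finitely many integral linear
   forms. If one of these forms does not vanish on g, its value there is
   polynomial in r and an l not dividing this value will do. Otherwise g^t is
   a product of commutators with exponents quadratic in r, and the same
   dichotomy applies to the relations satisfied by the e_ij; if again all forms
   vanish, then every l-th root of g is killed by a fixed exponent, which is
   then a suitable l. A nonzero N < 2^m has a non-divisor l <= 2m because
   m * 'C(2m, m) divides every common multiple of 1, ..., 2m. *)
Require Import Defs.
From mathcomp Require Import all_boot all_order all_algebra.
From mathcomp Require Import all_classical all_reals all_analysis.
From mathcomp Require Import zify ring lra.
Local Open Scope classical_set_scope.

Set Implicit Arguments.
Unset Strict Implicit.
Unset Printing Implicit Defensive.

Import Order.TTheory GRing.Theory Num.Theory.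

(** * Small non-divisors of an integer, via binomial coefficients *)

Lemma dvdn_mul_bin (d n m : nat) : 0 < m <= n ->
  (forall l, 0 < l <= n -> l %| d) -> m * 'C(n, m) %| d.
Proof.
(* Induction along the Leibniz harmonic triangle: with [u n m] the inverse of
   [m * 'C(n, m)], one has [u n.+1 m.+1 = u n m - u n.+1 m]. *)
case: m => // m /=; elim: m n => [|m IHm] [|n] // lt_mn dvd_d.
  by rewrite mul1n bin1 dvd_d /=.
have /dvdnP[a Da] : m.+1 * 'C(n, m.+1) %| d.
  by apply: IHm => // l ?; apply: dvd_d; lia.
have /dvdnP[b Db] : m.+1 * 'C(n.+1, m.+1) %| d by apply: IHm => //; lia.
have binE : m.+2 * 'C(n.+1, m.+2) = (n - m) * 'C(n.+1, m.+1).
  by rewrite mul_bin_left; congr (_ * _); lia.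
have binE' : (n - m) * 'C(n.+1, m.+1) = n.+1 * 'C(n, m.+1).
  by rewrite mul_bin_down; congr (_ * _); lia.
apply/dvdnP; exists (a - b); rewrite binE.
have [le_mn C_gt0] : (m < n)%N /\ (0 < 'C(n, m.+1))%N by rewrite bin_gt0; lia.
rewrite mulnBl {1}binE'.
apply/eqP; rewrite -(eqn_pmul2l (ltn0Sn m)) mulnBr.
have -> : m.+1 * (a * (n.+1 * 'C(n, m.+1))) = n.+1 * d by rewrite Da; nia.
have -> : m.+1 * (b * ((n - m) * 'C(n.+1, m.+1))) = (n - m) * d by rewrite Db; nia.
by apply/eqP; rewrite -mulnBl; congr (_ * _); lia.
Qed.

(** Pascal's rule and symmetry give ['C(2 * m + 2, m.+1) = 2 * 'C(2 * m + 1, m)], so the central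
    coefficient at least doubles at each step. *)
Lemma expn2_bin m : 2 ^ m <= 'C(2 * m, m).
Proof.
elim: m => // m IHm; rewrite expnS.
have -> : 2 * m.+1 = (2 * m).+2 by lia.
rewrite binS.
have e : 'C((2 * m).+1, m.+1) = 'C((2 * m).+1, m).
  by rewrite -bin_sub; [congr 'C(_, _); lia|lia].
by rewrite e addnn -mul2n leq_mul2l /= (leq_trans IHm) // leq_bin2l.
Qed.

Lemma exists_ndvdn (N m : nat) : 0 < N < 2 ^ m ->
  exists2 l, 0 < l <= 2 * m & ~~ (l %| N).
Proof.
move=> /andP[N_gt0 N_lt]; apply: contrapT => all_dvd.
have m_gt0 : 0 < m by case: m N_lt {all_dvd} => //; rewrite expn0; lia.
suff : m * 'C(2 * m, m) %| N.
  by move/(dvdn_leq N_gt0); have := expn2_bin m; nia.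
apply: dvdn_mul_bin => [|l l_le]; first by lia.
by apply: contrapT => /negP nd; apply: all_dvd; exists l.
Qed.

(** * Subgroups of Z^n *)

Section Lattices.
Local Open Scope ring_scope.

Lemma common_denominator m n (A : 'M[rat]_(m, n)) :
  exists (d : nat) (B : 'M[int]_(m, n)),
    (0 < d)%N /\ map_mx intr B = d%:R *: A.
Proof.
exists (\prod_i \prod_j `|denq (A i j)|)%N.
have dv i j : (`|denq (A i j)| %| \prod_i \prod_j `|denq (A i j)|)%N.
  by rewrite (bigD1 i) //= (bigD1 j) //= -!mulnA dvdn_mulr.
exists (\matrix_(i, j) (numq (A i j) *
   ((\prod_i \prod_j `|denq (A i j)|) %/ `|denq (A i j)|)%N%:Z)); split.
  apply: prodn_gt0 => i; apply: prodn_gt0 => j.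
  by rewrite absz_gt0 denq_eq0.
apply/matrixP => i j; rewrite !mxE.
move: (dv i j); set D := (\prod_i _)%N => /dvdnP[q ->].
rewrite mulnK ?absz_gt0 ?denq_eq0 // rmorphM /= natrM.
have -> : (`|denq (A i j)|%N%:R : rat) = (denq (A i j))%:~R.
  by rewrite -[RHS]/((denq (A i j))%:~R) -[in RHS]absz_denq.
rewrite -mulrA -[X in _ * (_ * X)]divq_num_den [in RHS](mulrC (denq _)%:~R).
by rewrite divfK ?intr_eq0 ?denq_eq0 // mulrC.
Qed.

(** A maximal independent family [V] of vectors of [L] spans the same rational space as [L].
    Clearing denominators in its cokernel gives [W], and in its pseudo-inverse gives [C]. The
    coordinates [c *m C] depend linearly on [c], which later keeps sizes under control. *)
Lemma lattice_saturation n (L : 'rV[int]_n -> Prop) :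
    L 0 -> (forall u v, L u -> L v -> L (u - v)) ->
  exists (t k : nat) (W : 'M[int]_n) (V : 'M[int]_(k, n)) (C : 'M[int]_(n, k)),
    [/\ (0 < t)%N, forall v, L v -> v *m W = 0, forall i, L (row i V)
      & forall c : 'rV_n, c *m W = 0 -> t%:R *: c = c *m (C *m V)].
Proof.
move=> L0 LB.
pose toQ m p (A : 'M[int]_(m, p)) : 'M[rat]_(m, p) := map_mx intr A.
pose indep k := `[< exists V : 'M[int]_(k, n),
  (forall i, L (row i V)) /\ row_free (toQ _ _ V) >].
have ex_indep : exists k, indep k.
  exists 0%N; apply/asboolP; exists 0; split; first by case.
  by rewrite /row_free -leqn0 rank_leq_row.
have indep_le k : indep k -> (k <= n)%N.
  by move=> /asboolP[V [_ /eqP <-]]; exact: rank_leq_col.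
case: (ex_maxnP ex_indep indep_le) => k /asboolP[V [LV freeV]] k_max.
(* Otherwise stacking [v] below [V] would give a larger independent family, against the maximality
   of [k]. *)
have L_sub v : L v -> (toQ _ _ v <= toQ _ _ V)%MS.
  move=> Lv; apply/negPn/negP => nsub.
  suff /k_max : indep (k + 1)%N by rewrite addn1 ltnn.
  apply/asboolP; exists (col_mx V v); split=> [i|].
    by case: (splitP i) => j ij;
      [have -> : i = lshift 1 j by exact: val_inj
      |have -> : i = rshift k j by exact: val_inj];
      rewrite ?rowKu // rowKd row_id.
  rewrite /row_free eqn_leq rank_leq_row /=.
  suff : (k < \rank (toQ _ _ (col_mx V v)))%N by lia.
  rewrite /toQ map_col_mx -addsmxE -{1}(eqP freeV).
  have : (toQ _ _ V < toQ _ _ V + toQ _ _ v)%MS.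
    rewrite ltmxE addsmxSl /=; apply: contra nsub.
    exact: submx_trans (addsmxSr _ _).
  by rewrite ltmxErank => /andP[].
have [d [W [d_gt0 WE]]] := common_denominator (cokermx (toQ _ _ V)).
have [t [C [t_gt0 CE]]] := common_denominator (pinvmx (toQ _ _ V)).
have toQ_inj m p (A B : 'M[int]_(m, p)) : toQ _ _ A = toQ _ _ B -> A = B.
  by move/matrixP=> AB; apply/matrixP => i j; have := AB i j; rewrite !mxE => /intr_inj.
have kerW v : (v *m W == 0) = (toQ _ _ v <= toQ _ _ V)%MS.
  rewrite submxE; apply/eqP/eqP => [/(congr1 (toQ _ _))|vW].
    rewrite /toQ map_mxM WE map_mx0 -scalemxAr => /eqP.
    by rewrite scaler_eq0 pnatr_eq0 -leqn0 leqNgt d_gt0 => /eqP.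
  by apply: toQ_inj; rewrite /toQ map_mxM WE map_mx0 -scalemxAr vW scaler0.
exists t, k, W, V, C; split=> // [v /L_sub | c /eqP].
  by rewrite -kerW => /eqP.
rewrite kerW => c_sub; apply: toQ_inj.
rewrite /toQ !map_mxM map_mxZ /= CE -scalemxAl -scalemxAr.
rewrite (mulmxA _ _ (map_mx _ V)) mulmxKpV //.
by rewrite rmorph_nat.
Qed.

(** The multiple [t%:R *: c] is an integral combination of rows of [V], and [L] is closed under such
    combinations. This form serves where no bound on the coefficients is tracked. *)
Lemma lattice_torsion n (L : 'rV[int]_n -> Prop) :
    L 0 -> (forall u v, L u -> L v -> L (u - v)) ->
  exists (t : nat) (W : 'M[int]_n),
    [/\ (0 < t)%N, forall v, L v -> v *m W = 0
      & forall c, c *m W = 0 -> L (t%:R *: c)].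
Proof.
move=> L0 LB.
have LN v : L v -> L (- v) by move=> Lv; rewrite -sub0r; exact: LB.
have LD u v : L u -> L v -> L (u + v) by move=> Lu Lv; rewrite -[v]opprK; apply/LB/LN.
have [t [k [W [V [C [t_gt0 LW LV VE]]]]]] := lattice_saturation L0 LB.
exists t, W; split=> // c /VE ->; rewrite mulmxA mulmx_sum_row.
elim/big_ind: _ => // i _; elim/int_ind: (_ 0 i) => [|m IHm|m IHm].
- by rewrite scale0r.
- by rewrite intS scalerDl scale1r; apply: LD.
- by rewrite intS opprD scalerDl scaleN1r; apply: LD => //; apply: LN.
Qed.

Lemma mulrn_row_eq0 n (u : 'rV[int]_n) m : (0 < m)%N -> u *+ m = 0 -> u = 0.
Proof.
move=> m_gt0 /rowP um0; apply/rowP => j; have := um0 j.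
by rewrite mulmxnE !mxE => /eqP; rewrite mulrn_eq0 eqn0Ngt m_gt0 => /eqP.
Qed.

Lemma leq_abszD (a b : int) : (`|(a + b)%R| <= `|a| + `|b|)%N.
Proof. lia. Qed.

Lemma mulmx_entry_bound m n (A : 'M[int]_(m, n)) :
  exists B : nat, forall (c : 'rV_m) (P : nat), (forall i, `|c 0%R i| <= P)%N ->
    forall j, (`|((c *m A) 0 j)%R| <= B * P)%N.
Proof.
exists (\sum_i \sum_j `|A i j|)%N => c P cP j.
have absz_sum (I : Type) (r : seq I) (F : I -> int) :
    (`|(\sum_(i <- r) F i)%R| <= \sum_(i <- r) `|F i|)%N.
  elim: r => [|i r IHr]; first by rewrite !big_nil.
  by rewrite !big_cons; apply: leq_trans (leq_abszD _ _) _; rewrite leq_add2l.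
rewrite mxE; apply: leq_trans (absz_sum _ _ _) _; rewrite big_distrl /=.
apply: leq_sum => i _; rewrite abszM mulnC; apply: leq_mul (cP i).
by rewrite (bigD1 j) //= leq_addr.
Qed.

End Lattices.

Local Open Scope group_scope.

(** * Integer powers and central elements *)

Section IntegerPowers.
Variable G : groupType.
Implicit Types (x y z : G) (a b : int).

Definition zpow x a : G :=
  match a with Posz n => x ^+ n | Negz n => x ^- n.+1 end.

Definition central z := forall y, commute z y.

Lemma zpow0 x : zpow x 0 = 1. Proof. by []. Qed.

Lemma zpow_nat x n : zpow x n%:Z = x ^+ n. Proof. by []. Qed.

Lemma zpowS x a : zpow x (a + 1)%R = zpow x a * x.
Proof.
case: a => [n|[|n]]; first by rewrite -PoszD /= addn1 expgSr.
  by rewrite /= mulVg.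
have -> : (Negz n.+1 + 1 = Negz n :> int)%R by lia.
by rewrite /= (expgS x n.+1) invgM mulgVK.
Qed.

Lemma zpowD x a b : zpow x (a + b)%R = zpow x a * zpow x b.
Proof.
elim/int_ind: b => [|n IHn|n IHn]; first by rewrite addr0 mulg1.
  have -> : (a + n.+1%:Z = (a + n%:Z) + 1)%R by lia.
  by rewrite zpowS IHn -mulgA -zpowS; congr (_ * zpow _ _); lia.
apply: (@mulIg _ x); rewrite -mulgA -!zpowS.
have -> : (- n.+1%:Z + 1 = - n%:Z)%R by lia.
by rewrite -IHn; congr zpow; lia.
Qed.

Lemma zpowN x a : zpow x (- a)%R = (zpow x a)^-1.
Proof. by apply/eqP; rewrite -mulg_eq1 -zpowD addNr. Qed.

Lemma zpowM x a b : zpow x (a * b)%R = zpow (zpow x a) b.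
Proof.
elim/int_ind: b => [|n IHn|n IHn]; first by rewrite mulr0.
  have -> : (a * n.+1%:Z = a * n%:Z + a)%R by lia.
  by rewrite -addn1 PoszD zpowS zpowD IHn.
apply: (@mulIg _ (zpow x a)); rewrite -zpowS -zpowD.
have -> : (- n.+1%:Z + 1 = - n%:Z)%R by lia.
by rewrite -IHn; congr zpow; lia.
Qed.

Lemma zpow_morph (f : G -> G) x a :
  (forall y z, f (y * z) = f y * f z) -> f (zpow x a) = zpow (f x) a.
Proof.
move=> fM; have f1 : f 1 = 1 by apply: (@mulgI _ (f 1)); rewrite -fM !mulg1.
have fX n : f (x ^+ n) = f x ^+ n by elim: n => // n IHn; rewrite !expgS fM IHn.
case: a => n //=; rewrite -fX; apply: (@mulIg _ (f (x ^+ n.+1))).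
by rewrite -fM !mulVg.
Qed.

Lemma central1 : central 1. Proof. by move=> y; rewrite /commute mul1g mulg1. Qed.

Lemma centralM x y : central x -> central y -> central (x * y).
Proof. by move=> cx cy z; rewrite /commute -mulgA cy !mulgA cx. Qed.

Lemma centralV x : central x -> central x^-1.
Proof. by move=> cx y; apply/commute_sym/commuteV/commute_sym. Qed.

Lemma centralX x n : central x -> central (x ^+ n).
Proof.
move=> cx; elim: n => [|n IHn]; first exact: central1.
by rewrite expgS; exact: centralM.
Qed.

Lemma central_zpow x a : central x -> central (zpow x a).
Proof. by case: a => n cx /=; [|apply: centralV]; apply: centralX. Qed.

Lemma central_prod I (r : seq I) (P : pred I) (F : I -> G) :
  (forall i, central (F i)) -> central (\prod_(i <- r | P i) F i).
Proof. by move=> cF; elim/big_ind: _ => //; [exact: central1|exact: centralM]. Qed.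

Lemma zpowMl x y a : central y -> zpow (x * y) a = zpow x a * zpow y a.
Proof.
move=> cy; have cyx z : z * y = y * z by rewrite cy.
have XM n : (x * y) ^+ n = x ^+ n * y ^+ n.
  elim: n => [|n IHn]; rewrite ?mulg1 // !expgS IHn -!mulgA; congr (_ * _).
  by rewrite cy -!mulgA (centralX n cy).
case: a => n //=; rewrite XM invgM; exact: (centralV (centralX _ cy)).
Qed.

Lemma prod_mul_central I (r : seq I) (F H : I -> G) :
    (forall i, central (H i)) ->
  \prod_(i <- r) (F i * H i) = (\prod_(i <- r) F i) * \prod_(i <- r) H i.
Proof.
move=> cH; elim: r => [|i r IHr]; first by rewrite !big_nil mulg1.
rewrite !big_cons IHr -!mulgA; congr (_ * _); rewrite !mulgA; congr (_ * _).
exact: cH.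
Qed.

End IntegerPowers.

(** * Commutator identities when all commutators are central *)

Section Class2.
Variable G : groupType.
Hypothesis comm_central : forall x y : G, central [~ x, y].
Implicit Types x y z : G.

Lemma commMl x y z : [~ x * y, z] = [~ x, z] * [~ y, z].
Proof.
have -> : [~ x * y, z] = [~ x, z] ^ y * [~ y, z].
  by rewrite !commgEl conjMg invgM conjMg /conjg !mulgA !(mulgK, mulgVK).
by congr (_ * _); rewrite /conjg comm_central mulKg.
Qed.

Lemma commMr x y z : [~ x, y * z] = [~ x, y] * [~ x, z].
Proof.
rewrite -invgR commMl invgM !invgR; exact: comm_central.
Qed.

Lemma comm_zpow x y (a b : int) :
  [~ zpow x a, zpow y b] = zpow [~ x, y] (a * b)%R.
Proof.
rewrite (@zpow_morph _ (fun u => [~ u, _])) => [|u v]; last exact: commMl.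
rewrite (@zpow_morph _ (fun u => [~ x, u])) => [|u v]; last exact: commMr.
by rewrite mulrC zpowM.
Qed.

(* The exponent of the commutator is the binomial coefficient ['C(2 * l, 2)]. *)
Lemma expg_mul_even x y l :
  (x * y) ^+ (2 * l) = x ^+ (2 * l) * y ^+ (2 * l) * ([~ y, x] ^+ (2 * l).-1) ^+ l.
Proof.
have XM n : (x * y) ^+ n = x ^+ n * y ^+ n * [~ y, x] ^+ 'C(n, 2).
  elim: n => [|n IHn]; first by rewrite !mulg1.
  have yXx : y ^+ n * x = x * y ^+ n * [~ y, x] ^+ n.
    by have := comm_zpow y x n 1; rewrite mulr1 /= expg1 => <-; exact: commgC.
  have c1 m := centralX m (comm_central y x).
  rewrite expgSr IHn -mulgA c1 !mulgA -(mulgA (x ^+ n)) yXx binS bin1 expgnDr !expgSr.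
  by rewrite -!mulgA; do 3!congr (_ * _); rewrite c1 -mulgA.
rewrite XM bin2 -mulnA (mul2n (_ * _)) doubleK (mulnC l).
by congr (_ * _); exact: expgnA.
Qed.
End Class2.

(** * Coordinates on groups of class two *)

Section NormalForm.
Variables (G : groupType) (n : nat) (x : 'I_n -> G).
Hypothesis comm_central : forall y z : G, central [~ y, z].
Implicit Types (g h : G) (a b c : 'rV[int]_n) (e f : 'M[int]_n) (P Q : nat).

Definition gprod c : G := \prod_i zpow (x i) (c 0%R i).

(** All ordered pairs occur, so the coordinates are redundant; the ambiguity is measured by the
    lattice of those [e] with [cprod e = 1]. *)
Definition cprod e : G := \prod_i \prod_j zpow [~ x i, x j] (e i j).

Lemma cprod_central e : central (cprod e).
Proof. by apply: central_prod => i; apply: central_prod => j; apply: central_zpow. Qed.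

Lemma cprodD e f : cprod (e + f)%R = cprod e * cprod f.
Proof.
rewrite /cprod -prod_mul_central => [|i]; last first.
  by apply: central_prod => j; apply: central_zpow.
apply: eq_bigr => i _; rewrite -prod_mul_central => [|j]; last exact: central_zpow.
by apply: eq_bigr => j _; rewrite mxE zpowD.
Qed.

Lemma cprod0 : cprod 0 = 1.
Proof. by apply: (@mulgI _ (cprod 0)); rewrite -cprodD addr0 mulg1. Qed.

Lemma cprodN e : cprod (- e)%R = (cprod e)^-1.
Proof. by apply/eqP; rewrite -mulg_eq1 -cprodD addNr cprod0. Qed.

Lemma cprodZ e m : cprod (e *+ m)%R = cprod e ^+ m.
Proof. by elim: m => [|m IHm]; rewrite ?mulr0n ?cprod0 // mulrS cprodD IHm expgS. Qed.

Lemma cprod_delta i j (v : int) : cprod (v *: delta_mx i j)%R = zpow [~ x i, x j] v.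
Proof.
rewrite /cprod (big_only1 i) //= => [|k ik _]; last first.
  by rewrite big1 // => l _; rewrite !mxE (negPf ik) mulr0.
rewrite (big_only1 j) //= => [|l jl _]; last by rewrite !mxE (negPf jl) andbF mulr0.
by rewrite !mxE !eqxx mulr1.
Qed.

(* Collecting the letters [x j] of the second factor moves them past the
   letters [x i] of the first one with [i] after [j]; [after i j] records these pairs. *)
Lemma gprodD : exists after : rel 'I_n, forall a b,
  gprod a * gprod b =
    gprod (a + b) * cprod (\matrix_(i, j) ((after i j)%:R * (a 0 i * b 0 j)))%R.
Proof.
(* The induction runs over a duplicate-free list. As [after i j] forces [j] into the list, the
   matrix obtained so far vanishes in the column of a new letter [k]. *)
suff [after afterE] : exists after : rel 'I_n, (forall i j, after i j -> j \in index_enum 'I_n) /\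
  forall a b, let X c := \prod_(i <- index_enum 'I_n) zpow (x i) (c 0%R i) in
  X a * X b = X (a + b)%R *
    cprod (\matrix_(i, j) ((after i j)%:R * (a 0 i * b 0 j)))%R.
  by exists after => a b; apply: afterE.2.
elim: (index_enum 'I_n) (index_enum_uniq 'I_n) => [_|k r IHr /= /andP[k_r r_uniq]].
  exists (fun _ _ => false); split=> // a b /=; rewrite !big_nil !mul1g -cprod0.
  by congr cprod; apply/matrixP => i j; rewrite !mxE mul0r.
have [after [after_r afterE]] := IHr r_uniq.
exists (fun i j => if j == k then i \in r else after i j); split=> [i j|a b].
  by rewrite inE; case: eqP => //= _ /after_r.
pose A := \prod_(i <- r) zpow (x i) (a 0%R i).
pose B := \prod_(i <- r) zpow (x i) (b 0%R i).
have commA : [~ A, zpow (x k) (b 0%R k)] =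
    cprod (\sum_(i <- r) (a 0 i * b 0 k) *: delta_mx i k)%R.
  rewrite {}/A {B afterE after_r k_r IHr r_uniq}; elim: r => [|i r IHr].
    by rewrite !big_nil comm1g cprod0.
  by rewrite !big_cons commMl // IHr comm_zpow // cprodD cprod_delta.
rewrite /= !big_cons mxE zpowD -/A -/B.
have -> : zpow (x k) (a 0%R k) * A * (zpow (x k) (b 0%R k) * B) =
    zpow (x k) (a 0%R k) * zpow (x k) (b 0%R k) * (A * B) * [~ A, zpow (x k) (b 0%R k)].
  set z := [~ _, _]; have cz : central z by exact: comm_central.
  rewrite -[LHS]mulgA -2![RHS]mulgA; congr (_ * _).
  by rewrite [LHS]mulgA (commgC A) -/z; clearbody z; rewrite -!mulgA cz.
rewrite commA afterE -!mulgA -cprodD; do 3!congr (_ * _); congr cprod.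
apply/matrixP => i j; rewrite !mxE summxE.
under eq_bigr do rewrite !mxE.
case: (eqVneq j k) => [->|_]; last first.
  by rewrite big1 ?addr0 // => u _; rewrite andbF mulr0.
have -> : after i k = false by apply/negP => /after_r; rewrite (negPf k_r).
rewrite mul0r add0r; have [ir|nir] := boolP (i \in r).
  rewrite (bigD1_seq i) //= eqxx mulr1 mul1r big1 ?addr0 // => u.
  by rewrite eq_sym => /negPf ->; rewrite mulr0.
rewrite mul0r big_seq big1 // => u ur; case: eqVneq => [iu|_]; last by rewrite mulr0.
by rewrite iu ur in nir.
Qed.

Lemma gprod0 : gprod 0 = 1.
Proof. by rewrite /gprod big1 // => i _; rewrite mxE. Qed.

Lemma gprod_delta i : gprod (delta_mx 0%R i) = x i.
Proof.
rewrite /gprod (big_only1 i) //= => [|j ij _]; last by rewrite mxE (negPf ij).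
by rewrite mxE !eqxx /= expg1.
Qed.

(* The size [P] is additive under products: the linear coordinates are bounded
   by [P], and the commutator coordinates, which grow quadratically, by [P ^ 2]. *)
Definition rep P c g := exists e,
  [/\ forall i, (`|c 0%R i| <= P)%N, forall i j, (`|e i j| <= P * P)%N
    & g = gprod c * cprod e].

Lemma rep_le P Q c g : (P <= Q)%N -> rep P c g -> rep Q c g.
Proof.
move=> PQ [e [cP eP ->]]; exists e; split=> // [i|i j]; first exact: leq_trans (cP i) PQ.
by apply: leq_trans (eP i j) _; apply: leq_mul.
Qed.

Lemma rep1 P : rep P 0 1.
Proof. by exists 0%R; split=> [i|i j|]; rewrite ?mxE // gprod0 cprod0 mulg1. Qed.

Lemma rep_gen i : rep 1 (delta_mx 0%R i) (x i).
Proof.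
exists 0%R; split=> [j|j k|]; rewrite ?mxE //; first by case: (_ && _).
by rewrite gprod_delta cprod0 mulg1.
Qed.

(** Collecting adds at most [P * Q] to a commutator coordinate, and [P * P + Q * Q + P * Q] is at
    most the square of [P + Q]. *)
Lemma repM P Q a b g h : rep P a g -> rep Q b h -> rep (P + Q) (a + b)%R (g * h).
Proof.
move=> [e [aP eP ->]] [f [bQ fQ ->]]; have [after afterE] := gprodD.
exists (\matrix_(i, j) ((after i j)%:R * (a 0 i * b 0 j)) + (e + f))%R; split=> [i|i j|].
- by rewrite mxE; apply: leq_trans (leq_abszD _ _) _; exact: leq_add.
- rewrite !mxE; have := eP i j; have := fQ i j.
  have : (`|((after i j)%:R * (a 0 i * b 0 j))%R| <= P * Q)%N.
    by case: (after i j); rewrite ?mul0r // mul1r abszM leq_mul.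
  move: (_%:R * _)%R (e i j) (f i j) => u v w uPQ;
  have := leq_abszD u (v + w)%R; have := leq_abszD v w; rewrite mulnDl !mulnDr (mulnC Q P); lia.
- rewrite cprodD [RHS]mulgA -afterE cprodD -!mulgA; congr (_ * _).
  by rewrite [LHS]cprod_central -!mulgA; congr (_ * _); exact: cprod_central.
Qed.

(** Inversion can double the bound [P * P] on the commutator coordinates; the factor 2 on [P] leaves
    room for this. *)
Lemma repV P c g : rep P c g -> rep (2 * P) (- c)%R g^-1.
Proof.
move=> [e [cP eP ->]]; have [after afterE] := gprodD.
exists (- (\matrix_(i, j) ((after i j)%:R * ((- c) 0 i * c 0 j)) + e))%R; split=> [i|i j|].
- by rewrite mxE abszN (leq_trans (cP i)) // leq_pmull.
- rewrite !mxE; have := eP i j.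
  have : (`|((after i j)%:R * (- c 0 i * c 0 j))%R| <= P * P)%N.
    by case: (after i j); rewrite ?mul0r // mul1r abszM abszN leq_mul.
  move: (_%:R * _)%R (e i j) => u v; rewrite abszN.
  by have := leq_abszD u v; rewrite mulnACA; lia.
- have := afterE (- c)%R c; rewrite addNr gprod0 mul1g => cE.
  have cz : central (gprod (- c)%R * (gprod c * cprod e)).
    by rewrite mulgA cE -cprodD; exact: cprod_central.
  by rewrite cprodN cprodD -cE -mulgA -(centralV cz) [in RHS]invgM mulgVK.
Qed.

Lemma repX P c g m : rep P c g -> rep (m * P) (c *+ m)%R (g ^+ m).
Proof.
move=> cg; elim: m => [|m IHm]; first by rewrite mulr0n; exact: rep1.
by rewrite mulrS expgS mulSn; exact: repM.
Qed.

Lemma rep_relationZ A c (m : int) :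
  rep A c 1 -> rep (2 * A * `|m|) (m *: c)%R 1.
Proof.
move=> c1; have nat_scale (u : 'rV[int]_n) k : (k%:Z *: u = u *+ k)%R.
  by rewrite -scaler_nat natz.
case: m => k; have := @repX A c 1 _ c1.
  move=> /(_ k); rewrite expg1n nat_scale; apply: rep_le => /=; nia.
move=> /(_ k.+1) /repV; rewrite expg1n invg1 NegzE scaleNr nat_scale.
by apply: rep_le; rewrite -NegzE /=; nia.
Qed.

Lemma rep_relation_sum k (A : 'I_k -> nat) (c : 'I_k -> 'rV[int]_n) :
  (forall i, rep (A i) (c i) 1) -> rep (\sum_i A i) (\sum_i c i)%R 1.
Proof.
move=> c1; elim/big_ind2: _ => // [|P a Q b Pa Qb]; first exact: rep1.
by rewrite -[1]mulg1; exact: repM.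
Qed.

(** The vectors [c] with [rep P c 1] for some [P] form a lattice. If [W] kills [c], then [t%:R *: c]
    combines finitely many fixed relations with coefficients linear in [P]; dividing [g ^+ t] by
    this relation leaves only commutators, with size still linear in [P]. *)
Lemma rep_linear_saturation : exists (t D : nat) (W : 'M[int]_n),
  [/\ (0 < t)%N, forall P c, rep P c 1 -> (c *m W = 0)%R
    & forall P c g, rep P c g -> (c *m W = 0)%R -> rep (D * P) 0 (g ^+ t)].
Proof.
pose L c := exists P, rep P c 1.
have L0 : L 0%R by exists 0%N; exact: rep1.
have LB u v : L u -> L v -> L (u - v)%R.
  move=> [P u1] [Q v1]; exists (P + 2 * Q)%N.
  by rewrite -[1]mulg1 -[X in _ * X]invg1; apply: repM => //; exact: repV.
have [t [k [W [V [C [t_gt0 LW LV VE]]]]]] := lattice_saturation L0 LB.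
have [A VA] : exists A, forall i, rep A (row i V) 1.
  have [F FV] := choice LV; exists (\sum_i F i)%N => i.
  by apply: rep_le (FV i); rewrite (bigD1 i) //= leq_addr.
have [B BC] := mulmx_entry_bound C.
(* In [D], the summand [t] accounts for [g ^+ t]; the other one for [k] relations of size [A],
   scaled by coefficients at most [B * P] and then inverted. *)
exists t, (t + 2 * (k * (2 * A * B)))%N, W; split=> // [P c c1|P c g cg cW].
  by apply: LW; exists P.
have /repV : rep (k * (2 * A * B) * P) (t%:R *: c)%R 1.
  rewrite VE // mulmxA mulmx_sum_row.
  apply: (@rep_le (\sum_(i < k) 2 * A * `|(c *m C)%R 0%R i|)).
    rewrite -[X in (_ <= X * _ * _)%N]card_ord -mulnA -sum_nat_const.
    apply: leq_sum => i _.
    rewrite -!mulnA !leq_mul2l; case: cg => e [cP _ _].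
    by rewrite (BC _ _ cP) orbT.
  by apply: rep_relation_sum => i; exact: rep_relationZ.
move=> /(repM (repX t cg)); rewrite invg1 mulg1 scaler_nat subrr.
by apply: rep_le; rewrite mulnDl -!mulnA.
Qed.

Lemma rep0P P g : rep P 0 g ->
  exists2 e : 'M[int]_n, forall i j, (`|e i j| <= P * P)%N & g = cprod e.
Proof. by move=> [e [_ eP ->]]; exists e; rewrite ?gprod0 ?mul1g. Qed.

(** Since [cprod] is a homomorphism on integer matrices, its kernel, flattened by [mxvec], is a
    lattice to which [lattice_torsion] applies. *)
Lemma cprod_saturation : exists (t : nat) (W : 'M[int]_(n * n)),
  [/\ (0 < t)%N, forall e, cprod e = 1 -> (mxvec e *m W = 0)%R
    & forall e, (mxvec e *m W = 0)%R -> cprod e ^+ t = 1].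
Proof.
pose L (u : 'rV[int]_(n * n)) := cprod (vec_mx u) = 1.
have L0 : L 0%R by rewrite /L linear0 cprod0.
have LB u v : L u -> L v -> L (u - v)%R.
  by rewrite /L linearB /= cprodD cprodN => -> ->; rewrite divg1.
have [t [W [t_gt0 LW WL]]] := lattice_torsion L0 LB.
exists t, W; split=> // e => [e1|/WL]; first by apply: LW; rewrite /L mxvecK.
by rewrite /L scaler_nat linearMn /= mxvecK cprodZ.
Qed.

(** On an [l]-th power the forms given by [W], and then [W2], take values divisible by [l], so a
    nonzero value excludes each [l] that does not divide it. *)
Lemma exists_not_power : (forall g, exists P c, rep P c g) ->
  exists C : nat, forall P g, (0 < P)%N -> (exists c, rep P c g) -> g <> 1 ->
    exists l, (0 < l <= C + 2 * trunc_log 2 (C * (P * P)))%N /\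
      forall h, g <> h ^+ l.
Proof.
move=> rep_all; have [t [D [W [t_gt0 LW WL]]]] := rep_linear_saturation.
have [t2 [W2 [t2_gt0 LW2 WL2]]] := cprod_saturation.
have [B BW] := mulmx_entry_bound W; have [B2 BW2] := mulmx_entry_bound W2.
(* The 2 absorbs the successor in [(trunc_log 2 N).+1], the product [t * t2] is the [l] of the last
   case, and the other summands bound the values of the two families of forms. *)
pose C := (2 + t * t2 + B + B2 * (D * D))%N; have C_ge2 : (2 <= C)%N by rewrite /C; lia.
have small_ndvd P N : (0 < N <= (B + B2 * (D * D)) * (P * P))%N ->
    exists2 l, (0 < l <= C + 2 * trunc_log 2 (C * (P * P)))%N & ~~ (l %| N)%N.
  move=> /andP[N_gt0 N_le].
  have [|l l_le l_N] := @exists_ndvdn N (trunc_log 2 N).+1.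
    by rewrite N_gt0 trunc_log_ltn.
  exists l => //; have : (trunc_log 2 N <= trunc_log 2 (C * (P * P)))%N.
    by apply: leq_trunc_log; rewrite (leq_trans N_le) // leq_mul2r; apply/orP; right; lia.
  by lia.
exists C => P g P_gt0 [c cg] g_neq1.
have powW l h : g = h ^+ l ->
    exists2 d, (exists Q, rep Q d h) & (c *m W = (d *m W) *+ l)%R.
  move=> gE; have [Q [d dh]] := rep_all h; exists d; first by exists Q.
  have /repV := repX l dh; rewrite -gE => /(repM cg); rewrite mulgV => /LW.
  by rewrite mulmxBl -scaler_nat -scalemxAl scaler_nat => /subr0_eq.
have [cW|/rV0Pn[j cWj]] := eqVneq (c *m W)%R 0%R; last first.
  have [|l l_le /negP l_ndvd] := small_ndvd P `|(c *m W)%R 0%R j|%N.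
    rewrite absz_gt0 cWj /=; case: cg => e [cP _ _].
    rewrite (leq_trans (BW _ _ cP _)) // mulnDl (leq_trans _ (leq_addr _ _)) //.
    by rewrite leq_mul2l leq_pmull ?orbT.
  exists l; split=> // h /powW[d _ dE]; apply: l_ndvd.
  by rewrite dE mulmxnE -mulr_natl abszM natz dvdn_mulr.
(* Forms vanishing on [g] vanish on each of its roots, as the integers have no torsion. *)
have pow_kernel l h : (0 < l)%N -> g = h ^+ l -> exists f, h ^+ t = cprod f.
  move=> l_gt0 /powW[d [Q dh]]; rewrite cW => /esym/(mulrn_row_eq0 l_gt0) dW.
  by have [f _ fE] := rep0P (WL _ _ _ dh dW); exists f.
have [e eP gtE] := rep0P (WL _ _ _ cg cW).
have pow_kernelW l h : (0 < l)%N -> g = h ^+ l -> exists2 f, h ^+ t = cprod f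
    & (mxvec e *m W2 = (mxvec f *m W2) *+ l)%R.
  move=> l_gt0 gE; have [f fE] := pow_kernel l h l_gt0 gE; exists f => //.
  have : cprod (e - f *+ l)%R = 1.
    by rewrite cprodD cprodN cprodZ -fE -gtE gE -!expgnA mulnC mulgV.
  move=> /LW2; rewrite linearB linearMn /= mulmxBl -scaler_nat -scalemxAl.
  by rewrite scaler_nat => /subr0_eq.
have [eW|/rV0Pn[j eWj]] := eqVneq (mxvec e *m W2)%R 0%R; last first.
  have [|l l_le /negP l_ndvd] := small_ndvd P `|(mxvec e *m W2)%R 0%R j|%N.
    rewrite absz_gt0 eWj /= mulnDl (leq_trans _ (leq_addl _ _)) //.
    rewrite -mulnA mulnACA; apply: BW2 => i; case/mxvec_indexP: i => i k.
    by rewrite mxvecE.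
  exists l; split=> // h gE.
  have [|f _ fE] := pow_kernelW l h _ gE; first by case/andP: l_le.
  by apply: l_ndvd; rewrite fE mulmxnE -mulr_natl abszM natz dvdn_mulr.
(* A root [h] would satisfy [h ^+ t = cprod f] with [f] in the kernel of [W2], whence
   [g = cprod f ^+ t2 = 1]. *)
exists (t * t2)%N; split=> [|h gE].
  by rewrite muln_gt0 t_gt0 t2_gt0 /C; lia.
have tt2_gt0 : (0 < t * t2)%N by rewrite muln_gt0 t_gt0.
have [f fE fW] := pow_kernelW _ h tt2_gt0 gE.
apply: g_neq1; rewrite gE expgnA fE WL2 //.
by move/esym: fW; rewrite eW => /(mulrn_row_eq0 tt2_gt0).
Qed.
End NormalForm.

(** * A normal subgroup of small index *)

Local Open Scope card_scope.

Lemma class2_comm_central (G : groupType) :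
  two_step_nilpotent G -> forall x y : G, central [~ x, y].
Proof.
move=> [lc2 _] x y z; apply/commgP/eqP.
suff : @lower_central G 2 [~ [~ x, y], z] by rewrite lc2.
apply: sub_gen_smallest; exists [~ x, y], z; split=> //.
by apply: sub_gen_smallest; exists x, y.
Qed.

(** The values of [f] meet every left coset, so the cosets are an image of the finite type [T];
    finiteness then provides the exact cardinal that [has_index] asks for. *)
Lemma has_index_le (G : groupType) (N : set G) (T : finType) (f : T -> G) :
    is_subgroup N -> (forall g, exists t, N (g^-1 * f t)) ->
  exists2 d, has_index N d & (d <= #|T|)%N.
Proof.
move=> [N1 NV] fN.
have NM : {in N &, forall u v, u * v \in N} by apply: group_closedM; split.
have Ninv : {in N, forall u, u^-1 \in N} by apply: group_closedV; split.
pose coset (i : 'I_#|T|) := left_coset (f (enum_val i)) N.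
have cosetE : [set left_coset g N | g in [set: G]] = coset @` setT.
  apply/seteqP; split=> [_ [g _ <-]|_ [i _ <-]]; last by exists (f (enum_val i)).
  have [t /mem_set gt] := fN g; exists (enum_rank t) => //.
  rewrite /coset enum_rankK; apply/seteqP; split=> _ [h /mem_set Nh <-].
    exists (g^-1 * f t * h); last by rewrite mulgA mulVKg.
    by apply: set_mem; apply: NM.
  exists ((g^-1 * f t)^-1 * h); first by apply: set_mem; apply: NM => //; apply: Ninv.
  by rewrite invgM invgK !mulgA mulgV mul1g.
have : [set left_coset g N | g in [set: G]] #<= `I_#|T|.
  rewrite cosetE; apply: card_le_trans (card_image_le _ _) _.
  by have := @card_II #|T|; rewrite card_eq_sym => /card_eqPle[].
move=> le_T; have /finite_setP[d Nd] : finite_set [set left_coset g N | g in [set: G]].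
  exact: card_le_finite le_T (finite_II _).
by exists d => //; rewrite -card_le_II -(card_le_eql Nd).
Qed.

Section PowerSubgroup.
Variables (G : groupType) (l : nat).
Hypothesis comm_central : forall y z : G, central [~ y, z].

(* The doubled exponent makes this set closed under products: the commutator
   produced by multiplying two [2 * l]-th powers is itself an [l]-th power. *)
Definition power_subgroup : set G :=
  [set g | exists u z, central z /\ g = u ^+ (2 * l) * z ^+ l].

Lemma power_subgroup_exp u : power_subgroup (u ^+ (2 * l)).
Proof. by exists u, 1; split; [exact: central1|rewrite expg1n mulg1]. Qed.

Lemma power_subgroup_root g : power_subgroup g -> exists h, g = h ^+ l.
Proof.
move=> [u [z [cz ->]]]; exists (u ^+ 2 * z).
by have := zpowMl (u ^+ 2) l cz; rewrite !zpow_nat expgnA => ->.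
Qed.

Lemma power_subgroupM g h :
  power_subgroup g -> power_subgroup h -> power_subgroup (g * h).
Proof.
move=> [u [z [cz ->]]] [v [w [cw ->]]].
have cc := centralX (2 * l).-1 (comm_central v u).
exists (u * v), (([~ v, u] ^+ (2 * l).-1)^-1 * (z * w)); split.
  by apply: centralM; [exact: centralV|exact: centralM].
have := zpowMl ([~ v, u] ^+ (2 * l).-1)^-1 l (centralM cz cw).
have := zpowMl z l cw; rewrite !zpow_nat => -> ->.
rewrite expg_mul_even // expVgn !mulgA mulgK -!mulgA; congr (_ * _).
by rewrite [LHS]mulgA (centralX l cz) -mulgA.
Qed.

Lemma power_subgroupV g : power_subgroup g -> power_subgroup g^-1.
Proof.
move=> [u [z [cz ->]]]; exists u^-1, z^-1; split; first exact: centralV.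
by rewrite invgM !expVgn; exact: (centralV (centralX l cz)).
Qed.

Lemma power_subgroup_normal : is_normal_subgroup power_subgroup.
Proof.
split; last first.
  move=> _ y [u [z [cz ->]]]; exists (u ^ y), z; split=> //.
  by rewrite conjMg conjXg; congr (_ * _); rewrite /conjg (centralX l cz) mulKg.
split; first by apply/mem_set; rewrite -(expg1n _ (2 * l)); exact: power_subgroup_exp.
move=> u v /set_mem Nu /set_mem Nv; apply/mem_set.
exact: power_subgroupM (power_subgroupV Nv).
Qed.

Lemma power_subgroup_index n (x : 'I_n -> G) :
    (0 < l)%N -> (forall g, exists c e, g = gprod x c * cprod x e) ->
  exists2 d, has_index power_subgroup d & (d <= (2 * l) ^ (n + n * n))%N.
Proof.
move=> l_gt0 gE; have m_gt0 : (0 < 2 * l)%N by lia.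
(* [K] is congruence modulo the power subgroup; it is compatible with products by normality. *)
pose K g h := power_subgroup (g^-1 * h).
have KM g h g' h' : K g h -> K g' h' -> K (g * g') (h * h').
  rewrite /K => gh gh'; have -> : (g * g')^-1 * (h * h') = (g^-1 * h) ^ g' * (g'^-1 * h').
    by rewrite invgM /conjg -!mulgA mulVKg.
  by apply: power_subgroupM => //; apply: power_subgroup_normal.2.
have K1 : K 1 1.
  by rewrite /K mulg1 invg1 -(expg1n _ (2 * l)); exact: power_subgroup_exp.
(* The remainder [r] does not depend on [y], so one choice function [R] reduces the exponents of all
   letters and commutators. *)
have Kpow (a : int) : exists r : 'I_(2 * l), forall y, K (zpow y a) (zpow y r%:Z).
  have : (0 <= (a %% (2 * l)%:Z)%Z)%R by rewrite modz_ge0 //; lia.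
  case rE : (a %% _)%Z => [r|] // _.
  have lt_r : (r < 2 * l)%N by rewrite -ltz_nat -rE ltz_pmod.
  exists (Ordinal lt_r) => y; rewrite /K -zpowN -zpowD /= -rE.
  have -> : (- a + (a %% (2 * l)%:Z)%Z = - (a %/ (2 * l)%:Z)%Z * (2 * l)%:Z)%R.
    by rewrite {1}(divz_eq a (2 * l)%:Z) opprD addrNK mulNr.
  by rewrite zpowM; exact: power_subgroup_exp.
have [R KR] := choice Kpow.
pose f (t : {ffun 'I_n -> 'I_(2 * l)} * {ffun 'I_n * 'I_n -> 'I_(2 * l)}) :=
  gprod x (\row_i (t.1 i)%:Z)%R * cprod x (\matrix_(i, j) (t.2 (i, j))%:Z)%R.
have [||d Nd d_le] := @has_index_le _ power_subgroup _ f.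
- exact: power_subgroup_normal.1.
- move=> g; have [c [e ->]] := gE g.
  exists ([ffun i => R (c 0%R i)], [ffun ij => R (e ij.1 ij.2)]).
  have KP I (r : seq I) F H : (forall i, K (F i) (H i)) ->
      K (\prod_(i <- r) F i) (\prod_(i <- r) H i).
    by move=> FH; apply: (@big_ind2 _ _ K) => // *; apply: KM.
  apply: (KM _ _ _ _); first by apply: (KP) => i; rewrite mxE ffunE.
  by apply: (KP) => i; apply: KP => j; rewrite mxE ffunE.
exists d => //; apply: leq_trans d_le _.
by rewrite card_prod !card_ffun card_prod !card_ord expnD.
Qed.
End PowerSubgroup.

(** * The residual finiteness growth *)

Section Generators.
Variables (G : groupType) (n : nat) (x : 'I_n -> G).
Hypothesis comm_central : forall y z : G, central [~ y, z].

Lemma rep_generated (X : set G) g :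
    (forall y, X y -> exists i, y = x i) -> generates X ->
  exists P c, rep x P c g.
Proof.
move=> Xx genX; have : gen X g by rewrite genX.
apply: (@smallest_sub _ _ X [set g | exists P c, rep x P c g]) => [|y /Xx[i ->]].
  split=> [|u v /set_mem[P [a ua]] /set_mem[Q [b vb]]]; apply/mem_set.
    by exists 0%N, 0%R; exact: rep1.
  by exists (P + 2 * Q)%N, (a - b)%R; apply: repM => //; apply: repV.
by exists 1%N, (delta_mx 0%R i); exact: rep_gen.
Qed.

(** The finite set [S] may differ from the family [x] that carries the coordinates. The constant
    sums the sizes of all elements of [S], doubled to cover inverses. *)
Lemma rep_word (S : set G) : finite_set S ->
    (forall g, exists P c, rep x P c g) ->
  exists A, forall g k, is_word_length S g k -> exists c, rep x (k * A) c g.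
Proof.
move=> /finite_seqP[s SE] rep_all; have [F FP] := choice rep_all.
pose A := (\sum_(y <- s) F y)%N; exists (2 * A)%N.
have repS y : S y -> exists c, rep x A c y.
  rewrite SE /= => sy; have [c yc] := FP y; exists c; apply: rep_le yc.
  by rewrite /A (big_rem y) //= leq_addr.
have repSV y : S y \/ S y^-1 -> exists c, rep x (2 * A) c y.
  case=> /repS[c yc]; first by exists c; apply: rep_le yc; lia.
  by exists (- c)%R; rewrite -[y]invgK; exact: repV.
move=> g k [w [wS ->]]; elim: k w wS => [|k IHk] w wS.
  by exists 0%R; rewrite big_ord0; exact: rep1.
have [a wa] := repSV _ (wS ord0); have [b wb] := IHk _ (fun i => wS (lift ord0 i)).
by exists (a + b)%R; rewrite big_ord_recl mulSn; exact: repM.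
Qed.
End Generators.

(** The slack 1 turns the bound on the infimum into a strict one, from which an actual word length
    can be extracted. *)
Lemma word_ball_length (R : realType) (G : groupType) (S : set G) (r : R) g :
  word_ball S r g -> exists2 k, is_word_length S g k & (k%:R <= r + 1)%R.
Proof.
rewrite /word_ball /= /word_norm /emin => le_r.
have : (ereal_inf [set (n%:R)%:E | n in [set k | is_word_length S g k]] < (r + 1)%:E)%E.
  by apply: le_lt_trans le_r _; rewrite lte_fin ltrDl.
by move=> /ereal_inf_lt[_ [k kw <-]]; rewrite lte_fin => /ltW; exists k.
Qed.

Lemma trunc_log_le_ln (R : realType) (N : nat) : (0 < N)%N ->
  ((trunc_log 2 N)%:R * ln 2 <= ln N%:R :> R)%R.
Proof.
move=> N_gt0; rewrite mulr_natl -lnXn // ler_ln ?posrE ?exprn_gt0 ?ltr0n //.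
by rewrite -natrX ler_nat trunc_logP.
Qed.

Section Divisibility.
Variables (R : realType) (G : groupType) (n : nat) (x : 'I_n -> G).
Hypothesis comm_central : forall y z : G, central [~ y, z].
Hypothesis rep_all : forall g, exists P c, rep x P c g.

Lemma divisibility_le : exists2 K : R, (0 < K)%R &
  forall P c g, (0 < P)%N -> rep x P c g -> g <> 1 ->
    (divisibility R g <= ((K * (1 + ln P%:R)) ^+ (n + n * n))%:E)%E.
Proof.
have [C powC] := exists_not_power comm_central rep_all.
have ln2_gt0 : (0 < ln 2 :> R)%R by rewrite ln_gt0 // ltr1n.
(* The successor keeps the argument of the logarithm positive even if [C] is 0. *)
pose M : R := (ln C.+1%:R)%R.
have M_ge0 : (0 <= M)%R by rewrite ln_ge0 // ler1n.
(* This comes from [2 * l <= 2 * C + 4 * (M + 2 * ln P) / ln 2]. *)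
pose K : R := (2 * C%:R + 4 * (M + 2) / ln 2)%R.
have K_gt0 : (0 < K)%R.
  by rewrite ltr_wpDl // ?mulr_ge0 // divr_gt0 // mulr_gt0 // ltr_wpDl.
exists K => // P c g P_gt0 cg g_neq1.
have [l [/andP[l_gt0 l_le] g_npow]] := powC P g P_gt0 (ex_intro _ c cg) g_neq1.
have [d Nd d_le] : exists2 d, has_index (@power_subgroup G l) d
    & (d <= (2 * l) ^ (n + n * n))%N.
  apply: (power_subgroup_index (x := x) comm_central l_gt0) => h.
  by have [Q [a [e [_ _ ->]]]] := rep_all h; exists a, e.
have : (divisibility R g <= (d%:R)%:E)%E.
  apply: ereal_inf_lbound; exists d => //; exists (@power_subgroup G l); split=> //.
    exact: power_subgroup_normal.
  by case/power_subgroup_root => h /g_npow.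
move=> /le_trans; apply; rewrite lee_fin.
have lnP_ge0 : (0 <= ln P%:R :> R)%R by rewrite ln_ge0 // ler1n.
have log_le : ((trunc_log 2 (C * (P * P)))%:R <= (M + 2 * ln P%:R) / ln 2 :> R)%R.
  rewrite ler_pdivlMr //.
  apply: (@le_trans _ _ ((trunc_log 2 (C.+1 * (P * P)))%:R * ln 2)%R).
    by rewrite ler_pM2r // ler_nat leq_trunc_log // leq_mul2r leqnSn orbT.
  apply: le_trans (trunc_log_le_ln _ _) _; first by rewrite !muln_gt0 P_gt0.
  by rewrite !natrM !lnM ?posrE ?mulr_gt0 ?ltr0n // -/M; lra.
have l_leR : ((2 * l)%:R <= K * (1 + ln P%:R) :> R)%R.
  have : (l%:R <= C%:R + 2 * (trunc_log 2 (C * (P * P)))%:R :> R)%R.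
    by rewrite -[(2 : R)%R]/(2%:R)%R -natrM -natrD ler_nat.
  have C_le : (0 <= C%:R * ln P%:R :> R)%R by rewrite mulr_ge0.
  have ln2V_gt0 : (0 < (ln 2 : R)^-1)%R by rewrite invr_gt0.
  have ML_le : (0 <= M * ln P%:R / ln 2)%R by rewrite !mulr_ge0 // ltW.
  rewrite natrM /K; move: log_le ML_le ln2V_gt0 C_le.
  move: (ln 2 : R)%R^-1%R (ln P%:R : R)%R => w L; nra.
apply: (@le_trans _ _ ((2 * l)%:R ^+ (n + n * n))%R).
  by rewrite -natrX ler_nat.
by apply: lerXn2r; rewrite ?nnegrE // (le_trans _ l_leR).
Qed.
End Divisibility.

Lemma RF_polylog (R : realType) (G : groupType) n (x : 'I_n -> G) m :
    (forall y z : G, central [~ y, z]) ->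
    (forall g, exists P c, rep x P c g) -> (n + n * n <= m)%N ->
  forall S : set G, finite_set S -> preceq (RF R S) (log_pow R m).
Proof.
move=> comm_central rep_all le_m S finS.
have [A wordA] := rep_word comm_central finS rep_all.
have [K K_gt0 divK] := divisibility_le R comm_central rep_all.
(* For [r >= 1] and [k <= r + 1] one has [k * A + 1 <= B * r]. The factor [expR 1] in [E] absorbs
   the summand 1 of [1 + ln P]. *)
pose B : R := (1 + 2 * A%:R)%R; pose E : R := (expR 1 * B)%R.
have B_ge1 : (1 <= B)%R by rewrite lerDl mulr_ge0.
have B_gt0 : (0 < B)%R by exact: lt_le_trans B_ge1.
have E_gt0 : (0 < E)%R by rewrite mulr_gt0 ?expR_gt0.
have KX_gt0 : (0 < K ^+ (n + n * n))%R by exact: exprn_gt0.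
(* A single constant has to dominate [E] inside the logarithm and the power of [K] outside it. *)
exists (E + K ^+ (n + n * n))%R; split; first exact: addr_gt0.
move=> r; rewrite ge_max => /andP[r_ge1 _].
have r_gt0 : (0 < r)%R by exact: lt_le_trans r_ge1.
have lnE : (ln (E * r) = 1 + ln (B * r) :> R)%R.
  by rewrite /E -mulrA lnM ?posrE ?expR_gt0 ?mulr_gt0 // expRK.
have lnB_ge0 : (0 <= ln (B * r))%R by rewrite ln_ge0 // -[1%R]mulr1 ler_pM.
have ln_le : (ln (E * r) <= ln ((E + K ^+ (n + n * n)) * r))%R.
  have EK_gt0 : (0 < (E + K ^+ (n + n * n)) * r)%R by rewrite mulr_gt0 // addr_gt0.
  rewrite ler_ln ?posrE //; first by rewrite ler_pM2r // lerDl ltW.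
  exact: mulr_gt0.
apply: ge_ereal_sup => _ [g [g_neq1 /word_ball_length[k kw k_le]] <-].
have [c gc] := wordA _ _ kw.
(* The size [k * A + 1] replaces [k * A] because [divK] requires a positive size. *)
have : (divisibility R g <= ((K * (1 + ln (k * A + 1)%:R)) ^+ (n + n * n))%:E)%E.
  by apply: (divK _ c) => //; [rewrite addn1|apply: rep_le gc; exact: leq_addr].
move=> /le_trans; apply; rewrite /log_pow -EFinM lee_fin exprMn.
have ln_leB : (1 + ln (k * A + 1)%:R <= ln (E * r) :> R)%R.
  rewrite lnE lerD2l ler_ln ?posrE ?ltr0n ?addn1 ?mulr_gt0 // -addn1 natrD natrM /B.
  have : (k%:R * A%:R <= (r + 1) * A%:R :> R)%R by rewrite ler_wpM2r.
  have : (0 <= (r - 1) * A%:R)%R by rewrite mulr_ge0 // subr_ge0.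
  lra.
have ln_ge0' : (0 <= 1 + ln (k * A + 1)%:R :> R)%R.
  by rewrite addr_ge0 // ln_ge0 // ler1n addn1.
(* This allows the exponent to be raised from [n + n * n] to [m]. *)
have ln_ge1 : (1 <= ln ((E + K ^+ (n + n * n)) * r))%R.
  by rewrite (le_trans _ ln_le) // lnE lerDl.
apply: ler_pM; [exact: ltW|exact: exprn_ge0|by rewrite lerDr ltW|].
apply: (@le_trans _ _ (ln ((E + K ^+ (n + n * n)) * r) ^+ (n + n * n))%R).
  by apply: lerXn2r; rewrite ?nnegrE ?(le_trans ln_leB) // (le_trans _ ln_ge1).
by apply: ler_weXn2l.
Qed.

Theorem theorem1p1 (R : realType) (G : groupType)
    (G_fg : finitely_generated G)
    (G_infinite : infinite_set [set: G])
    (G_nil2 : two_step_nilpotent G) :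
  exists k : nat, (0 < k)%N /\
    forall S : set G, finite_set S -> generates S ->
      preceq (RF R S) (log_pow R (2 * k + 1)%N).
Proof.
have [X [/finite_seqP[s XE] genX]] := G_fg.
have comm_central := class2_comm_central G_nil2.
have rep_all g : exists P c, rep (tnth (in_tuple s)) P c g.
  apply: (rep_generated comm_central g _ genX) => y; rewrite XE /= => sy.
  by have /tnthP[i ->] : y \in in_tuple s by []; exists i.
(* The exponent depends only on the fixed generating list [s], hence is the same for all [S]. *)
exists (size s + size s * size s).+1; split=> // S finS _.
by apply: (RF_polylog R comm_central rep_all) finS; lia.
Qed.
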